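(* Let an increasing price function $P:\mathbb{N}_{\ge 1}\to\mathbb{R}_{\ge 0}$ be given. All zone tariffs with overlap areas (ZOAs) with respect to $P$ (on all PTNs with zone covers) satisfy the no-stopover property if and only if $P$ is subadditive, i.e. $P(k_1+k_2)\le P(k_1)+P(k_2)$ for all $k_1,k_2\in\mathbb{N}_{\ge 1}$.
   Context: ''Increasing'' means non-decreasing. A PTN is a finite, simple, connected, undirected graph $(V,E)$. A path is a finite sequence $(x_1,\dots,x_n)$, $n\ge 1$, of (not necessarily distinct) nodes with consecutive nodes adjacent; $\mathcal{W}$ is the set of all paths; $[x_i,x_j]$ denotes the subpath $(x_i,\dots,x_j)$. A zone cover $\mathcal{Z}$ is a family of nonempty subsets of $V$ (zones) whose union is $V$; $\mathrm{zones}(v)\subseteq\mathcal{Z}$ is the (nonempty) set of zones containing $v$. For a path $W=(x_1,\dots,x_n)$, an assignment is a map $h:\{1,\dots,n\}\to\mathcal{Z}$ with $h(i)\in\mathrm{zones}(x_i)$; put $b^h(x_i,x_{i+1})=0$ if $h(i)=h(i+1)$ and $1$ otherwise, and $$z(W)=1+\min_h\sum_{i=1}^{n-1}b^h(x_i,x_{i+1}).$$ A fare structure $p:\mathcal{W}\to\mathbb{R}_{\ge 0}$ is a zone tariff with overlap areas (ZOA) with respect to an increasing $P$ if $p(W)=P(z(W))$ for all $W\in\mathcal{W}$. No-stopover property: $p([x_1,x_n])\le p([x_1,x_i])+p([x_i,x_n])$ for all paths $(x_1,\dots,x_n)\in\mathcal{W}$, $n\ge 3$, and all $i\in\{2,\dots,n-1\}$.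 *)

(* Defs.v *)
From mathcomp Require Import all_boot all_order all_algebra.
From mathcomp Require Import reals.

Set Implicit Arguments.
Unset Strict Implicit.
Unset Printing Implicit Defensive.

Import Order.TTheory GRing.Theory Num.Theory.

Local Open Scope ring_scope.

(* A price function lives on the integers >= 1; it is encoded as a function on
   nat whose value at 0 is never constrained nor used. *)
Section Prices.
Context {R : realType}.
Implicit Type P : nat -> R.

Definition price_nonneg P : Prop := forall k, (1 <= k)%N -> 0 <= P k.

Definition price_increasing P : Prop :=
  forall k l, (1 <= k)%N -> (k <= l)%N -> P k <= P l.

Definition price_subadditive P : Prop :=
  forall k1 k2, (1 <= k1)%N -> (1 <= k2)%N -> P (k1 + k2)%N <= P k1 + P k2.

End Prices.

Section Network.
Context {V : finType}.
Implicit Types (e : rel V) (W : seq V) (Z : {set {set V}}).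

Definition is_PTN e : Prop :=
  [/\ symmetric e, irreflexive e & forall x y, connect e x y].

Definition is_path e W : bool := (0 < size W)%N && sorted e W.

(* [x_i, x_j], where nodes are numbered from 1 and 1 <= i <= j <= size W. *)
Definition subpath W (i j : nat) : seq V := take (j - i).+1 (drop i.-1 W).

Definition zone_cover Z : bool := (set0 \notin Z) && (cover Z == [set: V]).

Definition zones Z (v : V) : {set {set V}} := [set A in Z | v \in A].

(* The map h : {1, ..., n} -> Z is encoded as the tuple (h(1), ..., h(n)). *)
Definition is_assignment Z W (h : (size W).-tuple {set V}) : bool :=
  [forall i : 'I_(size W), tnth h i \in zones Z (tnth (in_tuple W) i)].

Definition border_crossings (h : seq {set V}) : nat :=
  (\sum_(0 <= i < (size h).-1) (nth set0 h i != nth set0 h i.+1))%N.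

(* The base value size W is at least the number of border crossings of every
   assignment, and an assignment exists as soon as Z covers V, so this is one
   plus the true minimum: see zone_count_le and zone_count_attained. *)
Definition zone_count Z W : nat :=
  (1 + \big[minn/size W]_(h : (size W).-tuple {set V} | is_assignment Z h)
         border_crossings h)%N.

Lemma zone_count_le Z W (h : (size W).-tuple {set V}) :
  is_assignment Z h -> (zone_count Z W <= 1 + border_crossings h)%N.
Proof.
move=> hZ; rewrite /zone_count leq_add2l.
elim: (index_enum _) (mem_index_enum h) => // g s IHs.
rewrite inE big_cons => /predU1P[<-|/IHs les]; first by rewrite hZ geq_minl.
by case: ifP => // _; rewrite geq_min les orbT.
Qed.

Lemma zone_count_attained Z W : zone_cover Z ->
  exists2 h : (size W).-tuple {set V},
    is_assignment Z h & zone_count Z W = (1 + border_crossings h)%N.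
Proof.
case/andP=> _ /eqP covZ.
have zonesP x : exists A, A \in zones Z x.
  have : x \in cover Z by rewrite covZ inE.
  by case/bigcupP=> A AZ xA; exists A; rewrite inE AZ.
pose h0 := [tuple of map (fun x => xchoose (zonesP x)) (in_tuple W)].
have h0Z : is_assignment Z h0.
  by apply/forallP=> i; rewrite tnth_map; exact: xchooseP.
have crossings_le (h : (size W).-tuple {set V}) :
    (border_crossings h <= size W)%N.
  apply: (@leq_trans (size W).-1); last exact: leq_pred.
  rewrite /border_crossings size_tuple.
  apply: (@leq_trans (\sum_(0 <= i < (size W).-1) 1)).
    by apply: leq_sum => i _; exact: leq_b1.
  by rewrite sum_nat_const_nat muln1 subn0.
have [h hZ hmin] := arg_minnP (fun h : (size W).-tuple _ => border_crossings h)
  h0Z.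
exists h => //; congr (1 + _)%N; apply/eqP; rewrite eqn_leq; apply/andP; split.
  by have := zone_count_le hZ; rewrite /zone_count leq_add2l.
apply: (big_ind (fun m => (border_crossings h <= m)%N)) => //.
by move=> m n hm hn; rewrite leq_min hm.
Qed.

Context {R : realType}.
Implicit Types (p : seq V -> R) (P : nat -> R).

(* A fare structure is a function on paths; its values on sequences that are
   not paths are never constrained nor used. *)
Definition is_fare_structure e p : Prop := forall W, is_path e W -> 0 <= p W.

Definition is_ZOA e Z P p : Prop :=
  forall W, is_path e W -> p W = P (zone_count Z W).

Definition no_stopover e p : Prop :=
  forall W, is_path e W -> (3 <= size W)%N ->
  forall i, (2 <= i <= (size W).-1)%N ->
  p (subpath W 1 (size W)) <= p (subpath W 1 i) + p (subpath W i (size W)).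

End Network.

(* Main.v *)
Require Import Defs.
From mathcomp Require Import all_boot all_order all_algebra.
From mathcomp Require Import reals.

Set Implicit Arguments.
Unset Strict Implicit.
Unset Printing Implicit Defensive.

(** Breaking a path at an intermediate node never lowers the total zone count.
    If h1 and h2 are optimal assignments of the two parts, then h1 followed by
    h2 with its first zone dropped is an assignment of the whole path, and the
    only crossing that it may have beyond those of h1 and h2 is at the joint.
    Since each zone count is one plus a number of crossings, that crossing is
    absorbed by the second 1, whence z(W) <= z(W1) + z(W2)
    ([zone_count_stopover]). Monotonicity and subadditivity of P conclude.

    Conversely, equality z(W) = z(W1) + z(W2) = k1 + k2 occurs when the
    stopover node lies in the overlap of all zones. Take k1 + k2 zones, each
    made of one private node and of a common hub, let W1 visit k1 private nodes
    before stopping at the hub, and let W2 visit the other ones from the hub.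
    The hub adds nothing to either part, as it can be put in the zone of its
    neighbour ([hub_zone_count_left], [hub_zone_count_right]), while W has to
    use every zone ([hub_zone_count_ge]). With the monotonicity of P,
    no-stopover at the hub then reads P(k1 + k2) <= P(k1) + P(k2). *)

(** * Border crossings of a sequence of zones *)

Section Crossings.
Context {V : finType}.
Implicit Types (h s t : seq {set V}) (A B : {set V}).

Lemma border_crossings_cons2 A B s :
  border_crossings [:: A, B & s] = ((A != B) + border_crossings (B :: s))%N.
Proof. by rewrite /border_crossings /= big_nat_recl. Qed.

Lemma border_crossings1 A : border_crossings [:: A] = 0%N.
Proof. by rewrite /border_crossings big_geq. Qed.

Lemma border_crossings_cat A s B t :
  border_crossings ((A :: s) ++ B :: t) =
  (border_crossings (A :: s) + (last A s != B) + border_crossings (B :: t))%N.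
Proof.
elim: s A => [|C s IHs] A /=.
  by rewrite border_crossings_cons2 border_crossings1.
by rewrite !border_crossings_cons2 IHs !addnA.
Qed.

Lemma border_crossings_cat_le s t :
  (border_crossings (s ++ t) <= border_crossings s + 1 + border_crossings t)%N.
Proof.
case: s => [|A s]; first by rewrite leq_addl.
case: t => [|B t]; first by rewrite cats0 -addnA leq_addr.
by rewrite border_crossings_cat leq_add2r leq_add2l leq_b1.
Qed.

Lemma border_crossings_behead s :
  (border_crossings (behead s) <= border_crossings s)%N.
Proof.
case: s => [|A [|B s]] //=; first by rewrite /border_crossings !big_geq.
by rewrite border_crossings_cons2 leq_addl.
Qed.

Lemma border_crossings_size A s : (border_crossings (A :: s) <= size s)%N.
Proof.
elim: s A => [|B s IHs] A; first by rewrite border_crossings1.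
by rewrite border_crossings_cons2 -[size _]add1n leq_add ?leq_b1 ?IHs.
Qed.

(** Every zone but the first one has to be entered at least once. *)
Lemma size_undup_crossings s : (size (undup s) <= 1 + border_crossings s)%N.
Proof.
elim: s => [|A [|B s] IHs] //.
rewrite border_crossings_cons2 addnCA.
have [->|_] := eqVneq A B; first by rewrite /= in_cons eqxx.
apply: (@leq_trans (size (undup (B :: s))).+1); last by rewrite add1n ltnS.
by rewrite [undup [:: A, B & s]]/=; case: ifP => //= _; apply: leqnSn.
Qed.

End Crossings.

(** * Zone counts through sequences of zones *)

Section ZoneCount.
Context {V : finType}.
Implicit Types (Z : {set {set V}}) (W : seq V) (h : seq {set V}).

(** Untyped form of [is_assignment]: unlike tuples of a fixed length, sequences
    can be cut and concatenated freely. *)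
Definition assigns Z h W : bool := all2 (fun A v => A \in zones Z v) h W.

Lemma is_assignmentE Z W (h : (size W).-tuple {set V}) :
  is_assignment Z h = assigns Z h W.
Proof.
case: W h => [|v W] h; first by rewrite tuple0; apply/forallP => -[].
rewrite /assigns all2E size_tuple eqxx.
apply/forallP/(all_nthP (set0, v)) => [hZ i|hZ i].
- rewrite size_zip size_tuple minnn => ltiW; rewrite nth_zip ?size_tuple //=.
  by have := hZ (Ordinal ltiW); rewrite (tnth_nth set0) (tnth_nth v).
- have := hZ i; rewrite size_zip size_tuple minnn nth_zip ?size_tuple //=.
  by rewrite (tnth_nth set0) (tnth_nth v) /=; apply.
Qed.

Lemma assigns_size Z h W : assigns Z h W -> size h = size W.
Proof. by rewrite /assigns all2E => /andP[/eqP]. Qed.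

Lemma assigns_cat Z h1 h2 W1 W2 :
  assigns Z h1 W1 -> assigns Z h2 W2 -> assigns Z (h1 ++ h2) (W1 ++ W2).
Proof.
by elim: h1 W1 => [|A h1 IHh] [|v W1] //= /andP[-> hW1] hW2; apply: IHh.
Qed.

Lemma assigns_behead Z h v W : assigns Z h (v :: W) -> assigns Z (behead h) W.
Proof. by case: h => [|A h] //= /andP[]. Qed.

Lemma assigns_mem Z h W v :
  assigns Z h W -> v \in W -> exists2 A, A \in h & A \in zones Z v.
Proof.
elim: h W => [|A h IHh] [|w W] //= /andP[Aw hW]; rewrite inE => /predU1P[->|vW].
  by exists A; rewrite ?mem_head.
by have [B Bh Bv] := IHh _ hW vW; exists B; rewrite // inE Bh orbT.
Qed.

Lemma zone_count_le_assigns Z h W :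
  assigns Z h W -> (zone_count Z W <= 1 + border_crossings h)%N.
Proof.
move=> hZ; have hW : size h == size W by rewrite (assigns_size hZ).
by apply: (@zone_count_le _ Z W (Tuple hW)); rewrite is_assignmentE.
Qed.

Lemma zone_count_attained_assigns Z W : zone_cover Z ->
  exists2 h, assigns Z h W & zone_count Z W = (1 + border_crossings h)%N.
Proof.
by case/(zone_count_attained W) => h; rewrite is_assignmentE; exists h.
Qed.

(** The stopover node v may be assigned a different zone in each part. The
    joint assignment keeps its zone in the first part, so that the crossing
    from v to the next node is the only one not accounted for. *)
Lemma zone_count_stopover Z W1 v W2 : zone_cover Z ->
  (zone_count Z (W1 ++ v :: W2) <=
   zone_count Z (rcons W1 v) + zone_count Z (v :: W2))%N.
Proof.
move=> covZ; rewrite -cat_rcons.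
have [h1 h1Z ->] := zone_count_attained_assigns (rcons W1 v) covZ.
have [h2 h2Z ->] := zone_count_attained_assigns (v :: W2) covZ.
have hZ := assigns_cat h1Z (assigns_behead h2Z).
apply: leq_trans (zone_count_le_assigns hZ) _.
rewrite -addnA leq_add2l addnA.
apply: leq_trans (border_crossings_cat_le _ _) _.
by rewrite leq_add2l border_crossings_behead.
Qed.

End ZoneCount.

(** * Zones that overlap in a hub *)

Section Hub.
Context {I : finType}.
Implicit Types (i : I) (s : seq I).

(** The node None is the hub, and Some i is the private node of zone i. *)
Definition hub_zone i : {set option I} := [set Some i; None].

Definition hub_zones : {set {set option I}} := [set hub_zone i | i : I].

(** Completeness turns every duplicate-free sequence of nodes into a path, so
    that only the zones matter in the example. *)
Definition complete_rel : rel (option I) := [rel x y | x != y].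

Lemma complete_rel_PTN : is_PTN complete_rel.
Proof.
split=> [x y|x|x y]; first by rewrite /complete_rel /= eq_sym.
  by rewrite /complete_rel /= eqxx.
by have [->|xy] := eqVneq x y; [apply: connect0 | apply: connect1].
Qed.

Lemma uniq_path_complete (W : seq (option I)) :
  (0 < size W)%N -> uniq W -> is_path complete_rel W.
Proof.
by move=> W_gt0; rewrite /is_path W_gt0 uniq_pairwise => /pairwise_sorted.
Qed.

Lemma hub_zone_cover : (0 < #|I|)%N -> zone_cover hub_zones.
Proof.
case/card_gt0P=> i0 _; apply/andP; split.
  by apply/imsetP => -[i _ /setP/(_ None)]; rewrite !inE.
apply/eqP/setP => v; rewrite inE; apply/bigcupP.
by case: v => [i|]; [exists (hub_zone i) | exists (hub_zone i0)];
  rewrite ?imset_f ?inE ?eqxx ?orbT.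
Qed.

Lemma hub_zones_private i (A : {set option I}) :
  (A \in zones hub_zones (Some i)) = (A == hub_zone i).
Proof.
rewrite inE; apply/andP/eqP => [[/imsetP[j _ ->]]|->].
  by rewrite !inE orbF => /eqP[->].
by rewrite imset_f // !inE eqxx.
Qed.

Lemma hub_zones_hub i : hub_zone i \in zones hub_zones None.
Proof. by rewrite inE imset_f // !inE orbT. Qed.

Lemma hub_zone_inj : injective hub_zone.
Proof.
by move=> i j /setP/(_ (Some i)); rewrite !inE eqxx => /esym/orP[/eqP[]|].
Qed.

Lemma assigns_hub_private s :
  assigns hub_zones (map hub_zone s) (map Some s).
Proof.
by elim: s => //= i s IHs; rewrite hub_zones_private eqxx.
Qed.

(** Ending at the hub is free: it is put in the zone of the private node that
    precedes it. *)
Lemma hub_zone_count_left s : (0 < size s)%N ->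
  (zone_count hub_zones (rcons (map Some s) None) <= size s)%N.
Proof.
case: s => // i s _; rewrite -cats1.
have hZ : assigns hub_zones
    (map hub_zone (i :: s) ++ [:: last (hub_zone i) (map hub_zone s)])
    (map Some (i :: s) ++ [:: None]).
  apply: assigns_cat (assigns_hub_private _) _.
  by rewrite /= last_map hub_zones_hub.
apply: leq_trans (zone_count_le_assigns hZ) _.
rewrite border_crossings_cat eqxx border_crossings1 !addn0 add1n ltnS.
by rewrite -[leqRHS](size_map hub_zone) border_crossings_size.
Qed.

(** Starting from the hub is free for the symmetric reason. *)
Lemma hub_zone_count_right s : (0 < size s)%N ->
  (zone_count hub_zones (None :: map Some s) <= size s)%N.
Proof.
case: s => // i s _.
have hZ : assigns hub_zones (hub_zone i :: map hub_zone (i :: s))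
    (None :: map Some (i :: s)).
  rewrite -cat1s -[_ :: map _ _]cat1s.
  by apply: assigns_cat (assigns_hub_private _); rewrite /= hub_zones_hub.
apply: leq_trans (zone_count_le_assigns hZ) _.
rewrite border_crossings_cons2 eqxx add1n ltnS.
by rewrite -[leqRHS](size_map hub_zone) border_crossings_size.
Qed.

(** A private node leaves no choice of zone, and private nodes of distinct
    zones force distinct zones. *)
Lemma hub_zone_count_ge s (W : seq (option I)) : (0 < #|I|)%N ->
  uniq s -> {subset map Some s <= W} -> (size s <= zone_count hub_zones W)%N.
Proof.
move=> I_gt0 Us sW.
have [h hZ ->] := zone_count_attained_assigns W (hub_zone_cover I_gt0).
apply: leq_trans (size_undup_crossings h).
rewrite -(size_map hub_zone); apply: uniq_leq_size.
  by rewrite (map_inj_uniq hub_zone_inj).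
move=> _ /mapP[i si ->]; rewrite mem_undup.
have [|A Ah] := assigns_mem hZ (v := Some i); first exact/sW/map_f.
by rewrite hub_zones_private => /eqP <-.
Qed.

End Hub.

(** * The no-stopover property *)

Section Stopover.
Context {V : finType}.
Implicit Types W : seq V.

Lemma subpath_whole W : subpath W 1 (size W) = W.
Proof. by rewrite /subpath drop0 take_oversize // subn1 leqSpred. Qed.

Lemma subpath_before W1 v W2 :
  subpath (W1 ++ v :: W2) 1 (size W1).+1 = rcons W1 v.
Proof.
rewrite /subpath drop0 subn1 /= -cat_rcons -(size_rcons W1 v).
by rewrite take_size_cat.
Qed.

Lemma subpath_after W1 v W2 :
  subpath (W1 ++ v :: W2) (size W1).+1 (size (W1 ++ v :: W2)) = v :: W2.
Proof.
rewrite /subpath /= drop_size_cat // take_oversize //.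
by rewrite size_cat /= addnS subSS addKn.
Qed.

Lemma split_at_stopover W i : (2 <= i <= (size W).-1)%N ->
  exists W1 v W2, W = W1 ++ v :: W2 /\ i = (size W1).+1.
Proof.
case: W => [|v0 W]; first by case: i => [|[]].
case: i => [|i] //= /andP[_ ltiW].
have leiW : (i < size (v0 :: W))%N by rewrite ltnW.
exists (take i (v0 :: W)), (nth v0 (v0 :: W) i), (drop i.+1 (v0 :: W)).
by rewrite -drop_nth // cat_take_drop size_takel // ltnW.
Qed.

End Stopover.

Import Order.TTheory Num.Theory.
Local Open Scope ring_scope.

Lemma subadditive_no_stopover (R : realType) (P : nat -> R) (V : finType)
    (e : rel V) (Z : {set {set V}}) (p : seq V -> R) :
  price_increasing P -> price_subadditive P ->
  zone_cover Z -> is_ZOA e Z P p -> no_stopover e p.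
Proof.
move=> P_incr P_sub covZ pP W pathW _ i /split_at_stopover[W1 [v [W2 [defW ->]]]].
subst W; rewrite subpath_whole subpath_before subpath_after.
have [path1 path2] : is_path e (rcons W1 v) /\ is_path e (v :: W2).
  move: pathW; rewrite /is_path size_rcons /= => /andP[_].
  case: W1 => [|u W1] /=; first by [].
  by rewrite cat_path rcons_path => /= /and3P[-> -> ->].
rewrite !pP //.
apply: (le_trans
  (y := P (zone_count Z (rcons W1 v) + zone_count Z (v :: W2))%N)).
  by apply: P_incr => //; apply: zone_count_stopover.
exact: P_sub.
Qed.

(** The instance is the hub network with k1 + k2 zones. As P is increasing,
    one-sided bounds on the three zone counts yield the inequality. *)
Lemma no_stopover_subadditive (R : realType) (P : nat -> R) :
  price_nonneg P -> price_increasing P ->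
  (forall (V : finType) (e : rel V) (Z : {set {set V}}) (p : seq V -> R),
     is_PTN e -> zone_cover Z -> is_fare_structure e p -> is_ZOA e Z P p ->
     no_stopover e p) ->
  price_subadditive P.
Proof.
move=> P_ge0 P_incr nostop k1 k2 k1_gt0 k2_gt0.
pose I : finType := 'I_(k1 + k2).
pose s1 := take k1 (enum I); pose s2 := drop k1 (enum I).
have size_s1 : size s1 = k1 by rewrite size_takel // size_enum_ord leq_addr.
have size_s2 : size s2 = k2 by rewrite size_drop size_enum_ord addKn.
have Us : uniq (s1 ++ s2) by rewrite cat_take_drop enum_uniq.
have I_gt0 : (0 < #|I|)%N by rewrite card_ord addn_gt0 k1_gt0.
pose W := map Some s1 ++ None :: map Some s2.
have size_W : size W = (k1 + k2).+1.
  by rewrite size_cat /= !size_map size_s1 size_s2 addnS.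
have pathW : is_path (@complete_rel I) W.
  apply: uniq_path_complete; first by rewrite size_W.
  rewrite uniq_catC cat_cons -map_cat cons_uniq map_inj_uniq => [|i j [] //].
  by rewrite uniq_catC Us andbT; apply/mapP => -[].
pose p := fun W' : seq (option I) => P (zone_count hub_zones W').
have p_ge0 : is_fare_structure (@complete_rel I) p by move=> W' _; apply: P_ge0.
have := nostop _ _ _ p (@complete_rel_PTN I) (hub_zone_cover I_gt0) p_ge0
  (fun _ _ => erefl) W pathW.
have W_ge3 : (3 <= size W)%N by rewrite size_W ltnS (leq_add k1_gt0 k2_gt0).
have hub_inside : (2 <= (size (map Some s1)).+1 <= (size W).-1)%N.
  by rewrite size_W size_map size_s1 ltnS k1_gt0 -addn1 leq_add2l.
move=> /(_ W_ge3 _ hub_inside).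
rewrite subpath_whole subpath_before subpath_after => stop.
apply: le_trans (le_trans stop _).
- apply: P_incr; first by rewrite addn_gt0 k1_gt0.
  rewrite -{1}size_s1 -{1}size_s2 -size_cat; apply: hub_zone_count_ge => // v.
  by rewrite map_cat !mem_cat inE => /orP[]->; rewrite ?orbT.
- apply: lerD; apply: P_incr => //.
    by rewrite -[leqRHS]size_s1 hub_zone_count_left // size_s1.
  by rewrite -[leqRHS]size_s2 hub_zone_count_right // size_s2.
Qed.

Theorem theorem32 (R : realType) (P : nat -> R)
    (P_nonneg : price_nonneg P) (P_increasing : price_increasing P) :
  (forall (V : finType) (e : rel V) (Z : {set {set V}}) (p : seq V -> R),
     is_PTN e -> zone_cover Z -> is_fare_structure e p -> is_ZOA e Z P p ->
     no_stopover e p)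
  <-> price_subadditive P.
Proof.
split; first exact: no_stopover_subadditive.
by move=> P_sub V e Z p _ covZ _; apply: subadditive_no_stopover.
Qed.
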